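(* Let $\mathfrak{h}_1(s)=-\nu(s-1)\,e^{-\partial_s}-\nu(s)\,e^{\partial_s}+[2\sigma(s)+\tau(s)]I$ with $\nu(s)=\sqrt{\sigma(s+1)[\sigma(s)+\tau(s)]}$, let $\alpha\in\mathbb{R}$, and let $$a(s)=\mathfrak{a}^{\downarrow}_\alpha(s)=e^{-\alpha\partial_s}\left(e^{\partial_s}\sqrt{\sigma(s)}-\sqrt{\sigma(s)+\tau(s)}\,I\right),\qquad b(s)=\mathfrak{a}^{\uparrow}_\alpha(s)=\left(\sqrt{\sigma(s)}\,e^{-\partial_s}-\sqrt{\sigma(s)+\tau(s)}\,I\right)e^{\alpha\partial_s}.$$ Let $\Lambda$ be a complex number. Then the operators $a(s),b(s)$ factorize the Hamiltonian, i.e. $\mathfrak{h}_1(s)=b(s)a(s)$, and satisfy the commutation relation $[a(s),b(s)]=a(s)b(s)-b(s)a(s)=\Lambda I$, if and only if the following two conditions hold (identically in $s$): $$\frac{\sigma(s-\alpha)[\sigma(s-\alpha)+\tau(s-\alpha)]}{\sigma(s)[\sigma(s-1)+\tau(s-1)]}=1$$ and $$\sigma(s-\alpha+1)+\sigma(s-\alpha)+\tau(s-\alpha)-2\sigma(s)-\tau(s)=\Lambda.$$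
   Context: Here $\sigma$ and $\tau$ are the coefficients of the hypergeometric-type difference equation on the uniform lattice, $\sigma(s)\Delta\nabla y(s)+\tau(s)\Delta y(s)+\lambda y(s)=0$, where $\Delta f(s)=f(s+1)-f(s)$ and $\nabla f(s)=f(s)-f(s-1)$; $\sigma$ is a polynomial of degree at most $2$, $\tau$ a polynomial of degree at most $1$, with $\sigma$ and $\sigma+\tau$ not identically zero. The shift operator is $e^{\alpha\partial_s}f(s)=f(s+\alpha)$, and $I$ is the identity operator. A function of $s$ written in an operator expression denotes multiplication by that function, and products of operators denote composition (so $e^{\alpha\partial_s}f(s)=f(s+\alpha)e^{\alpha\partial_s}$ as operators). Identities between operators are identities of formal difference operators, i.e. equality of the coefficients of each shift $e^{k\partial_s}$. Square roots are handled formally and consistently: $\sqrt f\sqrt g=\sqrt{fg}$, $\sqrt f\sqrt f=f$, $\sqrt f=\sqrt g$ iff $f=g$, and shifting $\sqrt{f(s)}$ by $\beta$ gives $\sqrt{f(s+\beta)}$. *)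

(* Defs.v *)
From HB Require Import structures.
From mathcomp Require Import all_boot all_order all_algebra fraction.
From mathcomp Require Import boolp functions reals complex finmap monalg.

Set Implicit Arguments.
Unset Strict Implicit.
Unset Printing Implicit Defensive.

Import Order.TTheory GRing.Theory Num.Theory.
Local Open Scope ring_scope.
Local Open Scope complex_scope.

(* f(s) |-> f(s + beta) on polynomials in s *)
Definition pshift (R : realType) (beta : R) (f : {poly R[i]}) : {poly R[i]} :=
  f \Po ('X + (beta%:C)%:P).

(* Coefficient domain of the difference operators: a commutative ring that
   contains the complex polynomials in s, and on which the real shifts act.  It
   is left abstract because the square roots of polynomials live in it and are
   only specified by their formal rules (see formal_sqrt). *)
Record shift_ring (R : realType) := ShiftRing {
  coef_ring :> comNzRingType;
  of_poly : {rmorphism {poly R[i]} -> coef_ring};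
  shift : R -> {rmorphism coef_ring -> coef_ring};
  of_poly_inj : injective of_poly;
  shift0 : forall f, shift 0 f = f;
  shiftD : forall beta gamma f, shift (beta + gamma) f = shift beta (shift gamma f);
  shift_poly : forall beta p, shift beta (of_poly p) = of_poly (pshift beta p)
}.

Section Operators.
Context (R : realType) (F : shift_ring R).

(* Formal difference operators: A stands for the finite sum over k of
   A@_k e^{k d_s}, and A = B iff all the coefficients agree. *)
Definition diffop : zmodType := {malg F[R]}.

Definition fmul (f : F) : diffop := << f *g (0 : R) >>.

Definition eshift (beta : R) : diffop := << (1 : F) *g beta >>.

(* f e^{k d_s} composed with g e^{l d_s} is f(s) g(s + k) e^{(k + l) d_s}. *)
Definition opmul (A B : diffop) : diffop :=
  \sum_(k <- msupp A : seq R) \sum_(l <- msupp B : seq R)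
     << A@_k * shift F k (B@_l) *g k + l >>.

End Operators.

Declare Scope diffop_scope.
Delimit Scope diffop_scope with D.
Notation "A ** B" := (opmul A B)
  (at level 40, left associativity) : diffop_scope.
Local Open Scope diffop_scope.

(* The formal rules cannot hold for all polynomials at once: the root of f ^+ 2
   would be both f and - f.  They are required of the radicands that occur: the
   shifts of sigma, those of rho = sigma + tau, and products of one of each.
   This is always satisfiable, see formal_sqrt_exists. *)
Section FormalSqrt.
Context (R : realType) (sigma rho : {poly R[i]}).

Definition is_shift_of (g f : {poly R[i]}) : Prop :=
  exists beta : R, f = pshift beta g.

Definition radicand (f : {poly R[i]}) : Prop :=
  [\/ is_shift_of sigma f, is_shift_of rho f |
      exists f1 f2, [/\ is_shift_of sigma f1, is_shift_of rho f2 & f = f1 * f2]].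

Record formal_sqrt (F : shift_ring R) (sq : {poly R[i]} -> F) : Prop := {
  sq_mul : forall f g, is_shift_of sigma f -> is_shift_of rho g ->
    sq f * sq g = sq (f * g);
  sq_sqr : forall f, radicand f -> sq f * sq f = of_poly F f;
  sq_eq : forall f g, radicand f -> radicand g -> (sq f = sq g <-> f = g);
  sq_shift : forall beta f, radicand f -> shift F beta (sq f) = sq (pshift beta f)
}.

End FormalSqrt.

Section Hamiltonian.
Context (R : realType) (F : shift_ring R) (sq : {poly R[i]} -> F).
Context (sigma tau : {poly R[i]}).

Definition nu : F := sq (pshift 1 sigma * (sigma + tau)).

Definition hamiltonian : diffop F :=
  - (fmul (shift F (-1) nu) ** eshift F (-1)) - fmul nu ** eshift F 1
  + fmul (of_poly F (2%:R * sigma + tau)).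

Definition lowering (alpha : R) : diffop F :=
  eshift F (- alpha) ** (eshift F 1 ** fmul (sq sigma) - fmul (sq (sigma + tau))).

Definition raising (alpha : R) : diffop F :=
  (fmul (sq sigma) ** eshift F (-1) - fmul (sq (sigma + tau))) ** eshift F alpha.

End Hamiltonian.

(* Consistency of the rules: a model with functions C -> C as coefficients. *)
Section Model.
Context (R : realType).
Local Notation C := R[i].

Definition cfun : Type := C -> C.
HB.instance Definition _ := GRing.ComPzRing.on cfun.
Lemma cfun_oner_neq0 : (1 : cfun) != 0.
Proof.
by apply/eqP => /(congr1 (fun f : cfun => f 0)) /eqP; rewrite oner_eq0.
Qed.
HB.instance Definition _ :=
  GRing.PzSemiRing_isNonZero.Build cfun cfun_oner_neq0.

Lemma pshift_horner (beta : R) (p : {poly C}) (s : C) :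
  (pshift beta p).[s] = p.[s + beta%:C].
Proof. by rewrite /pshift horner_comp !hornerE. Qed.

Lemma poly_ext (p q : {poly C}) : (forall s, p.[s] = q.[s]) -> p = q.
Proof.
move=> h; apply/eqP; rewrite -subr_eq0; apply/negPn/negP => nz.
have := @max_poly_roots _ (p - q) [seq i%:R | i <- iota 0 (size (p - q))] nz.
rewrite size_map size_iota ltnn; move=> H.
suff: false by []; apply: H.
  by apply/allP => x _; rewrite /root hornerD hornerN h subrr.
rewrite map_inj_uniq ?iota_uniq // => i j /eqP.
by rewrite eqr_nat => /eqP.
Qed.

Definition fun_of_poly (p : {poly C}) : cfun := fun s => p.[s].

Lemma fun_of_poly_is_zmod : zmod_morphism fun_of_poly.
Proof. by move=> p q; apply/funext => s; rewrite /fun_of_poly hornerD hornerN. Qed.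
Lemma fun_of_poly_is_monoid : monoid_morphism fun_of_poly.
Proof.
split; first by apply/funext => s; rewrite /fun_of_poly hornerE.
by move=> p q; apply/funext => s; rewrite /fun_of_poly hornerM.
Qed.
HB.instance Definition _ :=
  GRing.isZmodMorphism.Build _ _ fun_of_poly fun_of_poly_is_zmod.
HB.instance Definition _ :=
  GRing.isMonoidMorphism.Build _ _ fun_of_poly fun_of_poly_is_monoid.

Definition fun_shift (beta : R) (f : cfun) : cfun := fun s => f (s + beta%:C).

Lemma fun_shift_is_zmod beta : zmod_morphism (fun_shift beta).
Proof. by []. Qed.
Lemma fun_shift_is_monoid beta : monoid_morphism (fun_shift beta).
Proof. by []. Qed.
HB.instance Definition _ beta :=
  GRing.isZmodMorphism.Build _ _ (fun_shift beta) (fun_shift_is_zmod beta).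
HB.instance Definition _ beta :=
  GRing.isMonoidMorphism.Build _ _ (fun_shift beta) (fun_shift_is_monoid beta).

Lemma fun_of_poly_inj : injective fun_of_poly.
Proof. by move=> p q h; apply: poly_ext => s; exact: (congr1 (@^~ s) h). Qed.

Lemma fun_shift0 f : fun_shift 0 f = f.
Proof. by apply/funext => s; rewrite /fun_shift rmorph0 addr0. Qed.

Lemma fun_shiftD beta gamma f :
  fun_shift (beta + gamma) f = fun_shift beta (fun_shift gamma f).
Proof. by apply/funext => s; rewrite /fun_shift rmorphD addrA. Qed.

Lemma fun_shift_poly beta p :
  fun_shift beta (fun_of_poly p) = fun_of_poly (pshift beta p).
Proof. by apply/funext => s; rewrite /fun_shift /fun_of_poly pshift_horner. Qed.

Definition fun_shift_ring : shift_ring R :=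
  @ShiftRing R cfun fun_of_poly fun_shift
    fun_of_poly_inj fun_shift0 fun_shiftD fun_shift_poly.

Definition msqrt (p : {poly C}) : cfun := fun s =>
  \prod_(z <- sval (closed_field_poly_normal p)) sqrtC (s - z).

Lemma prod_XsubC_perm (r1 r2 : seq C) :
  \prod_(z <- r1) ('X - z%:P) = \prod_(z <- r2) ('X - z%:P) -> perm_eq r1 r2.
Proof.
elim: r1 r2 => [|x r1 IH] r2.
  move=> /(congr1 (fun p : {poly C} => size p)).
  by rewrite !size_prod_XsubC; case: r2.
move=> h; have xr2 : x \in r2.
  by rewrite -root_prod_XsubC -h root_prod_XsubC mem_head.
rewrite (permPr (perm_to_rem xr2)) perm_cons; apply: IH.
move: h; rewrite (perm_big _ (perm_to_rem xr2)) /= !big_cons.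
by apply/mulfI; rewrite polyXsubC_eq0.
Qed.

Lemma msqrtE (p : {poly C}) c r s : c != 0 ->
  p = c *: \prod_(z <- r) ('X - z%:P) -> msqrt p s = \prod_(z <- r) sqrtC (s - z).
Proof.
move=> c0 pE; rewrite /msqrt; case: closed_field_poly_normal => r' /= pE'.
have lp : lead_coef p = c.
  by rewrite pE lead_coefZ lead_coef_prod_XsubC mulr1.
apply: perm_big; apply: prod_XsubC_perm.
by apply: (@scalerI _ _ c c0) => /=; rewrite -pE -{1}lp -pE'.
Qed.

Lemma msqrt_sqr (p : {poly C}) s : lead_coef p * (msqrt p s) ^+ 2 = p.[s].
Proof.
rewrite /msqrt; case: closed_field_poly_normal => r /= pE.
rewrite [in RHS]pE hornerZ horner_prod -prodrXl; congr (_ * _).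
by apply: eq_bigr => z _; rewrite sqrtCK !hornerE.
Qed.

Lemma msqrtM (p q : {poly C}) s : p != 0 -> q != 0 ->
  msqrt (p * q) s = msqrt p s * msqrt q s.
Proof.
move=> p0 q0; rewrite {2 3}/msqrt.
case: (closed_field_poly_normal p) => r /= pE.
case: (closed_field_poly_normal q) => t /= qE.
rewrite -big_cat /=; apply: (@msqrtE _ (lead_coef p * lead_coef q)).
  by rewrite mulf_neq0 ?lead_coef_eq0.
by rewrite {1}pE {1}qE big_cat /= -scalerAl -scalerAr scalerA.
Qed.

Lemma lead_pshift beta (p : {poly C}) : lead_coef (pshift beta p) = lead_coef p.
Proof.
rewrite /pshift lead_coef_comp ?size_XaddC //.
by rewrite lead_coefXaddC expr1n mulr1.
Qed.

Lemma pshiftM beta (p q : {poly C}) :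
  pshift beta (p * q) = pshift beta p * pshift beta q.
Proof. exact: comp_polyM. Qed.

Lemma pshift_pshift b c (p : {poly C}) :
  pshift b (pshift c p) = pshift (b + c) p.
Proof.
by apply: poly_ext => s; rewrite !pshift_horner rmorphD addrA.
Qed.

Lemma msqrt_pshift beta (p : {poly C}) s : p != 0 ->
  msqrt (pshift beta p) s = msqrt p (s + beta%:C).
Proof.
move=> p0; rewrite {2}/msqrt; case: closed_field_poly_normal => r /= pE.
rewrite (@msqrtE _ (lead_coef p) [seq z - beta%:C | z <- r]) ?lead_coef_eq0 //.
  rewrite big_map; apply: eq_bigr => z _; congr sqrtC.
  by rewrite opprB addrA addrAC.
apply: poly_ext => t; rewrite pshift_horner {1}pE !hornerZ; congr (_ * _).
rewrite !horner_prod big_map; apply: eq_bigr => z _.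
by rewrite !hornerE opprB addrA addrAC.
Qed.

Lemma formal_sqrt_exists (sigma rho : {poly R[i]}) :
  sigma != 0 -> rho != 0 ->
  exists (F : shift_ring R) (sq : {poly R[i]} -> F), formal_sqrt sigma rho sq.
Proof.
move=> s0 r0.
pose base f := is_shift_of sigma f \/ is_shift_of rho f.
pose ks := sqrtC (lead_coef sigma); pose kr := sqrtC (lead_coef rho).
pose k f : C := if `[< base f >] then sqrtC (lead_coef f) else ks * kr.
pose sq f : fun_shift_ring := (fun s => k f * msqrt f s) : C -> C.
exists fun_shift_ring, sq.
have leadS f : is_shift_of sigma f -> lead_coef f = lead_coef sigma.
  by case=> b ->; rewrite lead_pshift.
have leadR f : is_shift_of rho f -> lead_coef f = lead_coef rho.
  by case=> b ->; rewrite lead_pshift.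
have nzS f : is_shift_of sigma f -> f != 0.
  by move=> /leadS h; rewrite -lead_coef_eq0 h lead_coef_eq0.
have nzR f : is_shift_of rho f -> f != 0.
  by move=> /leadR h; rewrite -lead_coef_eq0 h lead_coef_eq0.
have kS f : is_shift_of sigma f -> k f = ks.
  by move=> h; rewrite /k asboolT ?(leadS _ h) //; left.
have kR f : is_shift_of rho f -> k f = kr.
  by move=> h; rewrite /k asboolT ?(leadR _ h) //; right.
have kM f g : is_shift_of sigma f -> is_shift_of rho g -> k (f * g) = ks * kr.
  move=> hf hg; rewrite /k; case: asboolP => // -[] h.
    have e := leadS _ h; rewrite lead_coefM (leadS _ hf) (leadR _ hg) in e.
    rewrite lead_coefM (leadS _ hf) (leadR _ hg) e.
    move: e; rewrite -[RHS]mulr1 => /mulfI; rewrite lead_coef_eq0 => /(_ s0).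
    by rewrite /kr => ->; rewrite sqrtC1 mulr1.
  have e := leadR _ h; rewrite lead_coefM (leadS _ hf) (leadR _ hg) in e.
  rewrite lead_coefM (leadS _ hf) (leadR _ hg) e.
  move: e; rewrite -[RHS]mul1r => /mulIf; rewrite lead_coef_eq0 => /(_ r0).
  by rewrite /ks => ->; rewrite sqrtC1 mul1r.
have shS b f : is_shift_of sigma f -> is_shift_of sigma (pshift b f).
  by case=> c ->; exists (b + c); rewrite pshift_pshift.
have shR b f : is_shift_of rho f -> is_shift_of rho (pshift b f).
  by case=> c ->; exists (b + c); rewrite pshift_pshift.
have sqM f g : is_shift_of sigma f -> is_shift_of rho g ->
    sq f * sq g = sq (f * g).
  move=> hf hg; apply/funext => s; rewrite /sq (kM _ _ hf hg) msqrtM ?(nzS f) ?(nzR g) //.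
  by rewrite mulrACA -(kS _ hf) -(kR _ hg).
have nz f : radicand sigma rho f -> f != 0.
  case=> [/nzS//|/nzR//|[f1 [f2 [h1 h2 ->]]]].
  by rewrite mulf_neq0 ?(nzS f1) ?(nzR f2).
have kk f : radicand sigma rho f -> k f ^+ 2 = lead_coef f.
  case=> [h|h|[f1 [f2 [h1 h2 ->]]]].
  - by rewrite (kS _ h) sqrtCK (leadS _ h).
  - by rewrite (kR _ h) sqrtCK (leadR _ h).
  - by rewrite kM // exprMn !sqrtCK lead_coefM (leadS _ h1) (leadR _ h2).
have sq2 f : radicand sigma rho f -> sq f * sq f = of_poly fun_shift_ring f.
  move=> h; apply/funext => s.
  transitivity ((k f * msqrt f s) ^+ 2); first by rewrite expr2.
  by rewrite exprMn kk // msqrt_sqr.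
split=> //.
- move=> f g hf hg; split=> [e|-> //].
  by apply: (@of_poly_inj R fun_shift_ring); rewrite -!sq2 // e.
- move=> b f h; apply/funext => s.
  transitivity (k f * msqrt f (s + b%:C)); first by [].
  rewrite /sq msqrt_pshift ?nz //; congr (_ * _).
  case: h => [h|h|[f1 [f2 [h1 h2 ->]]]].
  - by rewrite !kS //; apply: shS.
  - by rewrite !kR //; apply: shR.
  - by rewrite pshiftM !kM //; [apply: shS|apply: shR].
Qed.

End Model.

(* Main.v *)
Require Import Defs.
From HB Require Import structures.
From mathcomp Require Import all_boot all_order all_algebra fraction.
From mathcomp Require Import boolp functions reals complex finmap monalg.
From mathcomp Require Import ring.

(** Write rho = sigma + tau.  Once the shifts are moved to the right, a and b are
    two-term operators:
      a = sqrt(sigma(s + 1 - alpha)) e^{(1 - alpha) d_s}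
          - sqrt(rho(s - alpha)) e^{- alpha d_s},
      b = sqrt(sigma(s)) e^{(alpha - 1) d_s} - sqrt(rho(s)) e^{alpha d_s}.
    In b a the shifts by alpha cancel, and the four products that remain are
    exactly the Hamiltonian: the factorization is an identity
    ([raising_lowering]).  In a b the coefficients have been translated by
    - alpha, so the commutator is an operator with shifts 0, 1, -1
    ([commutatorE]), whose coefficients are
      shift  0 : sigma(s - alpha + 1) + rho(s - alpha) - sigma(s) - rho(s),
      shift  1 : sqrt(sigma(s + 1) rho(s))
                 - sqrt(sigma(s + 1 - alpha) rho(s + 1 - alpha)),
      shift -1 : sqrt(sigma(s) rho(s - 1))
                 - sqrt(sigma(s - alpha) rho(s - alpha)).
    The three shifts are distinct, so the commutator is Lambda I iff the first
    coefficient is Lambda and the other two vanish.  The first requirement is the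
    second condition of the theorem.  Equal formal roots have equal radicands, so
    the coefficient at -1 vanishes iff
    sigma(s - alpha) rho(s - alpha) = sigma(s) rho(s - 1), which is the first
    condition; the coefficient at 1 is, up to sign and one translation by 1, the
    same equation. *)

Set Implicit Arguments.
Unset Strict Implicit.
Unset Printing Implicit Defensive.

Import Order.TTheory GRing.Theory Num.Theory.
Local Open Scope ring_scope.
Local Open Scope diffop_scope.

(** Composition of difference operators is defined by nested sums over supports,
    and the support of a difference is not determined by the supports of its
    terms.  The lemmas of this section remove this obstacle once for all sums in
    which the summand depends additively on the coefficient. *)
Section MsuppSum.
Context (K : choiceType) (G V : zmodType).

Lemma msupp_sum_widen (phi : K -> {additive G -> V}) (g : {malg G[K]})
    (d : {fset K}) : (msupp g `<=` d)%fset ->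
  \sum_(k <- msupp g) phi k g@_k = \sum_(k <- d) phi k g@_k.
Proof.
move=> le_gd; apply: big_fset_incl => // k _ kNg.
by rewrite mcoeff_outdom ?raddf0.
Qed.

(** All three sums can be taken over the union of the supports of g and h, since
    an additive map kills the coefficients outside the support. *)
Lemma msupp_sumB (phi : K -> {additive G -> V}) (g h : {malg G[K]}) :
  \sum_(k <- msupp (g - h)) phi k (g - h)@_k =
  \sum_(k <- msupp g) phi k g@_k - \sum_(k <- msupp h) phi k h@_k.
Proof.
rewrite !(@msupp_sum_widen phi _ (msupp g `|` msupp h)%fset)
  ?msuppB_le ?fsubsetUl ?fsubsetUr // -sumrB.
by apply: eq_bigr => k _; rewrite mcoeffB raddfB.
Qed.

Lemma msupp_sumU (phi : K -> {additive G -> V}) (x : G) (k : K) :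
  \sum_(l <- msupp << x *g k >>) phi l << x *g k >>@_l = phi k x.
Proof. by rewrite (msupp_sum_widen phi msuppU_le) big_seq_fset1 mcoeffUU. Qed.

End MsuppSum.

Section Composition.
Context (R : realType) (F : shift_ring R).
Implicit Types (f g : F) (k l : R) (A B C : diffop F).

(** [coefr] and [coefl] are the summands of the two nested sums defining
    composition, each seen as a function of the one coefficient in which it is to
    be additive. *)
Definition coefr k l f : F -> diffop F := fun g => << f * shift F k g *g k + l >>.

Lemma coefr_is_zmod k l f : zmod_morphism (coefr k l f).
Proof. by move=> g h; rewrite /coefr rmorphB mulrBr monalgUB. Qed.
HB.instance Definition _ k l f :=
  GRing.isZmodMorphism.Build _ _ (coefr k l f) (coefr_is_zmod k l f).

Definition coefl k B : F -> diffop F :=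
  fun f => \sum_(l <- msupp B : seq R) << f * shift F k (B@_l) *g k + l >>.

Lemma coefl_is_zmod k B : zmod_morphism (coefl k B).
Proof.
move=> f g; rewrite /coefl -sumrB; apply: eq_bigr => l _.
by rewrite mulrBl monalgUB.
Qed.
HB.instance Definition _ k B :=
  GRing.isZmodMorphism.Build _ _ (coefl k B) (coefl_is_zmod k B).

Lemma opmulBl A B C : (A - B) ** C = A ** C - B ** C.
Proof. exact: (msupp_sumB (fun k => coefl k C)). Qed.

Lemma opmulBr A B C : A ** (B - C) = A ** B - A ** C.
Proof.
rewrite /opmul -sumrB; apply: eq_bigr => k _.
exact: (msupp_sumB (fun l => coefr k l A@_k)).
Qed.

Lemma opmulUU f g k l :
  (<< f *g k >> : diffop F) ** << g *g l >> = << f * shift F k g *g k + l >>.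
Proof.
transitivity (coefl k << g *g l >> f).
  exact: (msupp_sumU (fun k => coefl k << g *g l >>)).
exact: (msupp_sumU (fun l => coefr k l f)).
Qed.

(** Turns an equality of operators into equations in the coefficient ring; it
    rests on 0, 1 and -1 being distinct reals. *)
Lemma diffop3P (u v w c : F) :
  (<< u *g 0 >> + << v *g 1 >> + << w *g -1 >> : diffop F) = fmul c <->
  [/\ u = c, v = 0 & w = 0].
Proof.
have n10 : (1 == 0 :> R) = false by rewrite oner_eq0.
have nN10 : (-1 == 0 :> R) = false by rewrite oppr_eq0 oner_eq0.
have nN11 : (-1 == 1 :> R) = false.
  by apply/negbTE; rewrite lt_eqF // (lt_trans (ltrN10 _) ltr01).
split=> [e|[-> -> ->]]; last by rewrite !monalgU0 !addr0.
have coefE k := congr1 (mcoeff k) e.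
move: (coefE 0) (coefE 1) (coefE (-1)).
rewrite /fmul !mcoeffD !mcoeffU !eqxx.
rewrite ![0 == _]eq_sym [1 == -1]eq_sym n10 nN10 nN11.
by rewrite !mulr0n !mulr1n !addr0 !add0r.
Qed.

End Composition.

Section Pshift.
Context (R : realType).
Implicit Types (p q g : {poly R[i]}) (beta : R).

Lemma pshift0 p : pshift 0 p = p.
Proof. by apply: poly_ext => s; rewrite pshift_horner rmorph0 addr0. Qed.

Lemma pshiftD beta p q : pshift beta (p + q) = pshift beta p + pshift beta q.
Proof. exact: comp_polyD. Qed.

Lemma pshift_inj beta : injective (@pshift R beta).
Proof.
by apply: (can_inj (g := @pshift R (- beta))) => p; rewrite pshift_pshift addNr pshift0.
Qed.

Lemma pshift_eq0 beta p : (pshift beta p == 0) = (p == 0).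
Proof. by rewrite -lead_coef_eq0 lead_pshift lead_coef_eq0. Qed.

Lemma is_shift_of_refl g : is_shift_of g g.
Proof. by exists 0; rewrite pshift0. Qed.

Lemma is_shift_of_pshift g beta : is_shift_of g (pshift beta g).
Proof. by exists beta. Qed.

End Pshift.

#[local] Hint Resolve is_shift_of_refl is_shift_of_pshift : core.

Section Ladder.
Context (R : realType) (F : shift_ring R) (sigma tau : {poly R[i]}).
Context (sq : {poly R[i]} -> F) (alpha : R).
Local Notation rho := (sigma + tau).
Context (sqP : formal_sqrt sigma rho sq).
Local Notation a := (lowering sq sigma tau alpha).
Local Notation b := (raising sq sigma tau alpha).

(** Products of a shift of sigma and a shift of rho are the radicands to which the
    rule for equality of roots is applied. *)
Lemma radicandM f g : is_shift_of sigma f -> is_shift_of rho g ->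
  radicand sigma rho (f * g).
Proof. by constructor 3; exists f, g. Qed.

#[local] Hint Extern 0 (radicand _ _ _) =>
  solve [constructor 1; trivial | constructor 2; trivial
        | apply: radicandM; trivial] : core.

Lemma loweringE : a = << sq (pshift (1 - alpha) sigma) *g 1 - alpha >>
                    - << sq (pshift (- alpha) rho) *g - alpha >>.
Proof.
rewrite /lowering opmulBr /eshift /fmul !opmulUU !mul1r !addr0.
by rewrite !(sq_shift sqP) // pshift_pshift [- alpha + 1]addrC.
Qed.

Lemma raisingE : b = << sq sigma *g alpha - 1 >> - << sq rho *g alpha >>.
Proof.
rewrite /raising /eshift /fmul opmulUU !opmulBl !opmulUU !rmorph1 !mulr1.
by rewrite !add0r [-1 + _]addrC.
Qed.

(** The diagonal products give sigma + rho = 2 sigma + tau.  The mixed ones combine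
    by multiplicativity of the root into nu(s - 1) and nu(s), since both factors
    e^{(alpha - 1) d_s} and e^{alpha d_s} of b undo the translation by - alpha
    hidden in the coefficients of a. *)
Lemma raising_lowering : b ** a = hamiltonian sq sigma tau.
Proof.
rewrite raisingE loweringE opmulBl !opmulBr !opmulUU.
rewrite !(sq_shift sqP) // !pshift_pshift.
have -> : alpha - 1 + (1 - alpha) = 0 by ring.
have -> : alpha + (1 - alpha) = 1 by ring.
have -> : alpha - 1 - alpha = -1 by ring.
have -> : alpha - alpha = 0 by ring.
rewrite !pshift0 !(sq_sqr sqP) // [sq rho * _]mulrC !(sq_mul sqP) //.
rewrite /hamiltonian /nu /fmul /eshift !opmulUU !rmorph1 !mulr1 !add0r.
rewrite (sq_shift sqP) ?pshiftM ?pshift_pshift //.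
rewrite addNr pshift0.
have -> : 2%:R * sigma + tau = sigma + rho by ring.
rewrite [of_poly F (sigma + rho)]rmorphD monalgUD opprB.
by rewrite addrACA addrC.
Qed.

(** The coefficients are grouped by shift, in the form compared by [diffop3P]; the
    one at 0 is written as in the second condition of the theorem. *)
Lemma commutatorE : a ** b - b ** a =
  << of_poly F (pshift (- alpha + 1) sigma + pshift (- alpha) sigma
                + pshift (- alpha) tau - 2%:R * sigma - tau) *g 0 >>
  + << sq (pshift 1 sigma * rho)
       - sq (pshift (1 - alpha) sigma * pshift (1 - alpha) rho) *g 1 >>
  + << sq (sigma * pshift (-1) rho)
       - sq (pshift (- alpha) sigma * pshift (- alpha) rho) *g -1 >>.
Proof.
rewrite raisingE loweringE !opmulBl !opmulBr !opmulUU.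
rewrite !(sq_shift sqP) // !pshift_pshift.
have -> : alpha - 1 + (1 - alpha) = 0 by ring.
have -> : alpha + (1 - alpha) = 1 by ring.
have -> : alpha - 1 - alpha = -1 by ring.
have -> : alpha - alpha = 0 by ring.
have -> : 1 - alpha + (alpha - 1) = 0 by ring.
have -> : 1 - alpha + alpha = 1 by ring.
have -> : - alpha + (alpha - 1) = -1 by ring.
have -> : - alpha + alpha = 0 by ring.
rewrite !pshift0 !(sq_sqr sqP) //.
rewrite [sq rho * _]mulrC [sq (pshift _ rho) * _]mulrC !(sq_mul sqP) //.
have -> : pshift (- alpha + 1) sigma + pshift (- alpha) sigma
    + pshift (- alpha) tau - 2%:R * sigma - tau
  = pshift (1 - alpha) sigma + pshift (- alpha) rho - (sigma + rho).
  by rewrite pshiftD [- alpha + 1]addrC; ring.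
rewrite rmorphB [of_poly F (_ + pshift _ rho)]rmorphD [of_poly F (sigma + rho)]rmorphD.
rewrite !monalgUB !monalgUD !opprB opprD.
(* The atoms are regrouped according to their shift: 0, then 1, then -1. *)
by rewrite (AC ((2*2)*(2*2)) ((1*3*(8*6))*(5*2)*(7*4))).
Qed.

End Ladder.

Lemma tofrac_div_eq1 (D : idomainType) (p q : D) : q != 0 ->
  tofrac p / tofrac q = 1 <-> p = q.
Proof.
move=> q_neq0; have fq_neq0 : tofrac q != 0 by rewrite tofrac_eq0.
split=> [e|->]; last exact: divff.
by apply/eqP; rewrite -tofrac_eq -[tofrac p](divfK fq_neq0) e mul1r.
Qed.

Theorem theorem4p1 (R : realType) (F : shift_ring R) (sigma tau : {poly R[i]})
    (sq : {poly R[i]} -> F) (alpha : R) (Lambda : R[i]) :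
  (size sigma <= 3)%N -> (size tau <= 2)%N ->
  sigma != 0 -> sigma + tau != 0 ->
  formal_sqrt sigma (sigma + tau) sq ->
  let a := lowering sq sigma tau alpha in
  let b := raising sq sigma tau alpha in
  (hamiltonian sq sigma tau = b ** a /\
   a ** b - b ** a = fmul (of_poly F Lambda%:P))
  <->
  (tofrac (pshift (- alpha) sigma * (pshift (- alpha) sigma + pshift (- alpha) tau))
     / tofrac (sigma * (pshift (-1) sigma + pshift (-1) tau)) = 1 /\
   pshift (- alpha + 1) sigma + pshift (- alpha) sigma + pshift (- alpha) tau
     - 2%:R * sigma - tau = Lambda%:P).
Proof.
move=> _ _ sigma_neq0 rho_neq0 sqP a b.
rewrite -!pshiftD tofrac_div_eq1; last by rewrite mulf_neq0 ?pshift_eq0.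
rewrite (commutatorE alpha sqP) raising_lowering // diffop3P.
split=> [[_ [/of_poly_inj lam _ /eqP]]|[cross ->]].
  (* The coefficient at shift -1 alone gives the first condition. *)
  rewrite subr_eq0 => /eqP /(sq_eq sqP) <- //; exact: radicandM.
split=> //; split=> //; apply/eqP; rewrite subr_eq0; apply/eqP.
  (* At shift 1, translating back by 1 reduces the radicands to the condition. *)
  congr sq; apply: (@pshift_inj _ (-1)).
  by rewrite !pshiftM !pshift_pshift !addrA !addNr !add0r pshift0 cross.
by rewrite cross.
Qed.
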